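(* Let $K_A\subseteq V_A$ and $K_B\subseteq V_B$ be convex bodies admitting conic lifts $K_A=T_A(C_A\cap L_A)$ and $K_B=T_B(C_B\cap L_B)$, where $L_A=\{y_A\in W_A: R_A(y_A)=r_A\}$ and $L_B=\{y_B\in W_B:R_B(y_B)=r_B\}$. Let $P\in(V_A\otimes V_B)^\star$ and define $\tilde P\in(W_A\otimes W_B)^\star$ by $\tilde P(y_A\otimes y_B)=P(T_A(y_A)\otimes T_B(y_B))$ for $y_A\in W_A,y_B\in W_B$, extended linearly. Then the problem $$p^*=\min\{P(x_A\otimes x_B):x_A\in K_A,\ x_B\in K_B,\ F_A(x_A)=0,\ F_B(x_B)=0,\ G_A(x_A)\ge0,\ G_B(x_B)\ge0\}$$ is equivalent to the lifted conic program $$\begin{aligned}p^*=\inf_{(y_A,y_B)\in C_A\times C_B}\ &\tilde P(y_A\otimes y_B)\\ \text{s.t. }\ &F_A(T_A(y_A))=0,\quad F_B(T_B(y_B))=0,\\ &G_A(T_A(y_A))\ge0,\quad G_B(T_B(y_B))\ge0,\\ &R_A(y_A)=r_A,\quad R_B(y_B)=r_B,\end{aligned}$$ that is, $(y_A,y_B)\mapsto(T_A(y_A),T_B(y_B))$ maps the feasible set of the lifted program onto the feasible set of the original problem and preserves the objective value, so both problems have the same optimal value $p^*$.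
   Context: All vector spaces are finite-dimensional and real. A convex body is a nonempty compact convex set. $W_A,W_B$ are vector spaces, $C_A\subseteq W_A$, $C_B\subseteq W_B$ are proper cones (closed, convex, generating, pointed), $T_A:W_A\to V_A$, $T_B:W_B\to V_B$ are linear maps, $R_A:W_A\to U_A'$, $R_B:W_B\to U_B'$ are linear maps into vector spaces, and $r_A\in U_A'$, $r_B\in U_B'$; $L_A,L_B$ are the affine subspaces described in the claim. A conic ($C$-)lift of $K$ is a representation $K=T(C\cap L)$ with $T$ linear, $C$ a proper cone and $L$ an affine subspace. $F_A:V_A\to U_A$, $F_B:V_B\to U_B$ are linear maps into vector spaces and $G_A$, $G_B$ are linear maps from $V_A$, $V_B$ into ordered vector spaces.
   Formalization: The optimal values are taken as infima in the extended reals (+∞ if infeasible); that the original problem's minimum is attained is claimed only when it is feasible and the positive cones of the ordered vector spaces are closed, since otherwise the min need not exist. *)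

(* Defs.v *)
From HB Require Import structures.
From mathcomp Require Import all_boot all_order all_algebra.
From mathcomp Require Import all_classical all_reals all_analysis.

Set Implicit Arguments.
Unset Strict Implicit.
Unset Printing Implicit Defensive.

Import Order.TTheory GRing.Theory Num.Theory.
Import numFieldNormedType.Exports.

Local Open Scope classical_set_scope.
Local Open Scope ring_scope.

Section coordinates.
Context {R : realType} {V : vectType R}.

Definition coords (v : V) : 'rV[R]_(\dim {:V}) :=
  \row_i coord (vbasis {:V}) i v.

(* A [vectType] carries no topology: the unique Hausdorff vector space topology
   of V is transported from that of row vectors along the linear isomorphism
   [coords]. *)
Definition vclosed (A : set V) : Prop := closed (coords @` A).
Definition vcompact (A : set V) : Prop := compact (coords @` A).

End coordinates.

Definition convex_body (R : realType) (V : vectType R) (K : set V) : Prop :=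
  [/\ K !=set0, vcompact K & convex_set (K : set (convex_lmodType V))].

(* Nonemptiness, hence [C 0], follows from [proper_cone_generating]. *)
Record proper_cone (R : realType) (V : vectType R) (C : set V) : Prop := {
  proper_cone_scale : forall (a : R) x, 0 <= a -> C x -> C (a *: x);
  proper_cone_closed : vclosed C;
  proper_cone_convex : convex_set (C : set (convex_lmodType V));
  proper_cone_generating : forall w, exists x y, [/\ C x, C y & w = x - y];
  proper_cone_pointed : forall x, C x -> C (- x) -> x = 0 }.

(* [Num.POrderedZmodule] alone does not relate the order to the operations. *)
HB.mixin Record Vector_isOrdered (R : numDomainType) E
    of Vector R E & Num.POrderedZmodule E := {
  ovs_leD2r : forall x y z : E, x <= y -> x + z <= y + z;
  ovs_scale_ge0 : forall (a : R) (x : E), 0 <= a -> 0 <= x -> 0 <= a *: x }.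

#[short(type="orderedVectType")]
HB.structure Definition OrderedVector (R : numDomainType) :=
  {E of Vector R E & Num.POrderedZmodule E & Vector_isOrdered R E}.

(* The tensor product is realised by the matrices of coordinates in the product
   basis; its universal property is [tensor_extE] and [tensor_hom_eq]. *)
Definition tensor (R : fieldType) (V W : vectType R) :=
  'M[R]_(\dim {:V}, \dim {:W}).

Section tensor_product.
Context {R : fieldType} {V W : vectType R}.

Definition tens (x : V) (y : W) : tensor V W :=
  \matrix_(i, j) (coord (vbasis {:V}) i x * coord (vbasis {:W}) j y).

Lemma tens_is_bilinear : bilinear_for *:%R *:%R tens.
Proof.
split=> [y a x x'|x a y y']; apply/matrixP => i j; rewrite !mxE linearP /=.
  by rewrite mulrDl mulrA.
by rewrite mulrDr mulrCA.
Qed.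

HB.instance Definition _ :=
  bilinear_isBilinear.Build R V W (tensor V W) *:%R *:%R tens tens_is_bilinear.

Section extension.
Context {Z : vectType R}.

Definition tensor_ext_fun (b : V -> W -> Z) (M : tensor V W) : Z :=
  \sum_i \sum_j M i j *: b (vbasis {:V})`_i (vbasis {:W})`_j.

Lemma tensor_ext_fun_is_linear b : linear (tensor_ext_fun b).
Proof.
move=> a M N; rewrite /tensor_ext_fun scaler_sumr -big_split.
apply: eq_bigr => i _; rewrite scaler_sumr -big_split.
by apply: eq_bigr => j _; rewrite !mxE scalerDl scalerA.
Qed.

HB.instance Definition _ b :=
  GRing.isLinear.Build R (tensor V W) Z _ (tensor_ext_fun b)
    (tensor_ext_fun_is_linear b).

Definition tensor_ext (b : V -> W -> Z) : 'Hom(tensor V W, Z) :=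
  linfun (tensor_ext_fun b).

Lemma tensor_extE (b : {bilinear V -> W -> Z}) x y :
  tensor_ext b (tens x y) = b x y.
Proof.
rewrite lfunE /= /tensor_ext_fun.
rewrite [in RHS](coord_vbasis (memvf x)) linear_sumlz.
apply: eq_bigr => i _; rewrite linearZl_LR /=.
rewrite [in RHS](coord_vbasis (memvf y)) linear_sumr scaler_sumr.
by apply: eq_bigr => j _; rewrite linearZr_LR /= scalerA mxE.
Qed.

Lemma tensor_hom_eq (f g : 'Hom(tensor V W, Z)) :
  (forall x y, f (tens x y) = g (tens x y)) -> f = g.
Proof.
move=> fg; apply/lfunP => M; rewrite (matrix_sum_delta M) !linear_sum.
apply: eq_bigr => i _; rewrite !linear_sum; apply: eq_bigr => j _.
rewrite !linearZ; congr (_ *: _).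
suff -> : delta_mx i j = tens (vbasis {:V})`_i (vbasis {:W})`_j by exact: fg.
by apply/matrixP => k l; rewrite !mxE !coord_free ?(basis_free (vbasisP _))//
  -natrM mulnb (eq_sym i) (eq_sym j).
Qed.

End extension.
End tensor_product.

Notation "x \ox y" := (tens x y) (at level 40, left associativity) : ring_scope.

Section lifted_functional.
Context {R : fieldType} {VA VB WA WB : vectType R}.
Variables (P : 'Hom(tensor VA VB, R^o)).
Variables (TA : 'Hom(WA, VA)) (TB : 'Hom(WB, VB)).

Definition lifted_form (yA : WA) (yB : WB) : R^o := P (TA yA \ox TB yB).

Lemma lifted_form_is_bilinear : bilinear_for *:%R *:%R lifted_form.
Proof.
split=> [yB a y y'|yA a y y'] /=; rewrite /lifted_form.
  by rewrite linearP linearPl linearP.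
by rewrite linearP linearPr linearP.
Qed.

HB.instance Definition _ :=
  bilinear_isBilinear.Build R WA WB R^o *:%R *:%R
    lifted_form lifted_form_is_bilinear.

Definition lifted_functional : 'Hom(tensor WA WB, R^o) :=
  tensor_ext lifted_form.

Lemma lifted_functionalE yA yB :
  lifted_functional (yA \ox yB) = P (TA yA \ox TB yB).
Proof. exact: tensor_extE. Qed.

End lifted_functional.

Section programs.
Context {R : realType}.

(* The value is +oo when the problem is infeasible. *)
Definition optimal_value (X : Type) (D : set X) (f : X -> R) : \bar R :=
  ereal_inf [set (f x)%:E | x in D].

Context {VA VB UA UB : vectType R} {OA OB : orderedVectType R}.
Variables (FA : 'Hom(VA, UA)) (FB : 'Hom(VB, UB)).
Variables (GA : 'Hom(VA, OA)) (GB : 'Hom(VB, OB)).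

Definition feasible (KA : set VA) (KB : set VB) : set (VA * VB) :=
  [set x | [/\ KA x.1 /\ KB x.2,
               FA x.1 = 0 /\ FB x.2 = 0 &
               0 <= GA x.1 /\ 0 <= GB x.2]].

Context {WA WB UA' UB' : vectType R}.
Variables (TA : 'Hom(WA, VA)) (TB : 'Hom(WB, VB)).
Variables (RA : 'Hom(WA, UA')) (RB : 'Hom(WB, UB')) (rA : UA') (rB : UB').

Definition lifted_feasible (CA : set WA) (CB : set WB) : set (WA * WB) :=
  [set y | [/\ CA y.1 /\ CB y.2,
               FA (TA y.1) = 0 /\ FB (TB y.2) = 0,
               0 <= GA (TA y.1) /\ 0 <= GB (TB y.2) &
               RA y.1 = rA /\ RB y.2 = rB]].

End programs.

(* Main.v *)
Require Import Defs.
From mathcomp Require Import all_boot all_order all_algebra.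
From mathcomp Require Import all_classical all_reals all_analysis.

Import Order.TTheory GRing.Theory Num.Theory.
Import numFieldNormedType.Exports.

Local Open Scope classical_set_scope.
Local Open Scope ring_scope.

(** Both problems have the same value because the feasible set of the lifted
    program is sent by [(TA, TB)] onto the feasible set of the original one: the
    constraints involving [F] and [G] are pulled back along [T], while membership
    in [K] is, by the definition of a lift, the existence of a preimage in [C]
    with [R y = r] ([lifted_feasible_image]). The lifted functional is the
    original one precomposed with the same map, so the two problems take the same
    set of objective values, hence have the same infimum
    ([optimal_value_image]).

    The infimum is a minimum for topological reasons. The two parties are
    constrained independently, so the feasible set is a product
    ([feasible_setX]), each factor being the intersection of a compact convex
    body with closed sets, namely preimages under linear maps of {0} and of the
    positive cone ([vcompact_slice]). The objective is a bilinear form, hence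
    jointly continuous, and the extreme value theorem applies
    ([bilinear_attains_min]). The topology of a vector space being transported
    from row vectors by [coords], every continuity statement is reduced to
    that of the entries of a row vector, by expanding vectors in a basis. *)

Section coordinate_isomorphism.
Context {R : realType} {V : vectType R}.

Definition of_coords (u : 'rV[R]_(\dim {:V})) : V :=
  \sum_i u 0 i *: (vbasis {:V})`_i.

Lemma coordsK : cancel (@coords R V) of_coords.
Proof.
move=> v; rewrite [RHS](coord_vbasis (memvf v)).
by apply: eq_bigr => i _; rewrite mxE.
Qed.

Lemma of_coordsK : cancel of_coords (@coords R V).
Proof.
move=> u; apply/rowP => i; rewrite mxE.
by rewrite coord_sum_free// (basis_free (vbasisP _)).
Qed.

(** Transported topological notions are defined with direct images; preimages
    commute with intersections and with composition of maps. *)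
Lemma coords_image (A : set V) : coords @` A = of_coords @^-1` A.
Proof.
apply/seteqP; split=> [_ [x Ax <-]|u Au] /=; first by rewrite coordsK.
by exists (of_coords u) => //; exact: of_coordsK.
Qed.

End coordinate_isomorphism.

Section vector_space_topology.
Context {R : realType} {V W : vectType R}.

(** In coordinates [f] is the sum of the entries of [u] times fixed vectors, the
    images of the basis. *)
Lemma coords_linear_continuous (f : 'Hom(V, W)) :
  continuous (coords \o f \o of_coords).
Proof.
have -> : coords \o f \o of_coords =
    fun u : 'rV[R]_(\dim {:V}) => \sum_i u 0 i *: coords (f (vbasis {:V})`_i).
  apply/funext => u /=; apply/rowP => k; rewrite mxE summxE !linear_sum.
  by apply: eq_bigr => i _; rewrite !linearZ /= !mxE.
apply: continuous_big => [|i _]; first exact: add_continuous.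
move=> u; apply: continuousZ; last exact: cst_continuous.
exact: (@coord_continuous R 1 _ 0 i u).
Qed.

Lemma vclosed_preimage (f : 'Hom(V, W)) (A : set W) :
  vclosed A -> vclosed (f @^-1` A).
Proof.
rewrite /vclosed !coords_image => clA.
have -> : of_coords @^-1` (f @^-1` A) =
    (coords \o f \o of_coords) @^-1` (of_coords @^-1` A).
  by apply/funext => u /=; rewrite coordsK.
by apply: preimage_closed => // u _; exact: coords_linear_continuous.
Qed.

Lemma vclosed_set1 (x : V) : vclosed [set x].
Proof.
rewrite /vclosed image_set1.
exact/accessible_closed_set1/hausdorff_accessible/norm_hausdorff.
Qed.

Lemma vcompact_closedI (K A : set V) :
  vcompact K -> vclosed A -> vcompact (K `&` A).
Proof.
rewrite /vcompact /vclosed !coords_image preimage_setI.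
exact: compact_closedI.
Qed.

(** In coordinates [b] is a polynomial in the entries of both arguments, hence
    continuous on the product space, not merely in each variable. *)
Lemma bilinear_attains_min (b : {bilinear V -> W -> R^o})
    {K : set V} {L : set W} : vcompact K -> vcompact L -> K `*` L !=set0 ->
  exists2 x, (K `*` L) x & forall y, (K `*` L) y -> b x.1 x.2 <= b y.1 y.2.
Proof.
move=> cK cL [[v w] [/= Kv Lw]].
pose g (z : 'rV[R]_(\dim {:V}) * 'rV[R]_(\dim {:W})) : R^o :=
  b (of_coords z.1) (of_coords z.2).
have gE : g = fun z =>
    \sum_i \sum_j z.1 0 i *: (z.2 0 j *: b (vbasis {:V})`_i (vbasis {:W})`_j).
  apply/funext => z; rewrite /g linear_sumlz; apply: eq_bigr => i _.
  rewrite linear_sumr; apply: eq_bigr => j _.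
  by rewrite linearZl_LR linearZr_LR.
have gcont : continuous g.
  rewrite gE; apply: continuous_big => [|i _]; first exact: add_continuous.
  apply: continuous_big => [|j _]; first exact: add_continuous.
  move=> z; refine (@continuousZ R R^o _ _ _ z _ _).
    apply: (@continuous_comp _ _ _ fst (fun u : 'rV_(_) => u 0 i)).
      exact: cvg_fst.
    exact: coord_continuous.
  refine (@continuousZ R R^o _ _ _ z _ _); last exact: cst_continuous.
  apply: (@continuous_comp _ _ _ snd (fun u : 'rV_(_) => u 0 j)).
    exact: cvg_snd.
  exact: coord_continuous.
have ne : (coords @` K) `*` (coords @` L) !=set0.
  by exists (coords v, coords w); split; [exists v|exists w].
have [c] := compact_EVT_min ne (compact_setX cK cL)
  (continuous_subspaceT gcont).
rewrite inE => -[[x Kx xc] [y Ly yc]] minc.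
exists (x, y) => // -[x' y'] [/= Kx' Ly'].
have := minc (coords x', coords y'); rewrite /g -xc -yc /= !coordsK; apply.
by rewrite inE; split; [exists x'|exists y'].
Qed.

End vector_space_topology.

Lemma vcompact_slice {R : realType} {V U : vectType R} {O : orderedVectType R}
    (F : 'Hom(V, U)) (G : 'Hom(V, O)) {K : set V} :
  vcompact K -> vclosed [set u : O | 0 <= u] ->
  vcompact (K `&` (F @^-1` [set 0] `&` G @^-1` [set u | 0 <= u])).
Proof.
move=> cK clO; rewrite setIA; apply: vcompact_closedI; last first.
  exact: vclosed_preimage.
by apply: vcompact_closedI => //; exact/vclosed_preimage/vclosed_set1.
Qed.

(** No constraint couples the two parties, which lets each factor be treated on
    its own. *)
Lemma feasible_setX (R : realType) (VA VB UA UB : vectType R)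
    (OA OB : orderedVectType R)
    (FA : 'Hom(VA, UA)) (FB : 'Hom(VB, UB))
    (GA : 'Hom(VA, OA)) (GB : 'Hom(VB, OB)) (KA : set VA) (KB : set VB) :
  feasible FA FB GA GB KA KB =
  (KA `&` (FA @^-1` [set 0] `&` GA @^-1` [set u | 0 <= u])) `*`
  (KB `&` (FB @^-1` [set 0] `&` GB @^-1` [set u | 0 <= u])).
Proof.
apply/seteqP; split=> -[x y] /= [].
  by move=> [? ?] [? ?] [? ?].
by move=> [? [? ?]] [? [? ?]].
Qed.

(** A feasible [x] only provides separate preimages [yA] and [yB]; these form a
    feasible pair because no lifted constraint couples them and those involving
    [F] and [G] depend on [TA yA] and [TB yB] alone. *)
Lemma lifted_feasible_image (R : realType)
    (VA VB WA WB UA UB UA' UB' : vectType R) (OA OB : orderedVectType R)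
    (FA : 'Hom(VA, UA)) (FB : 'Hom(VB, UB))
    (GA : 'Hom(VA, OA)) (GB : 'Hom(VB, OB))
    (TA : 'Hom(WA, VA)) (TB : 'Hom(WB, VB))
    (RA : 'Hom(WA, UA')) (RB : 'Hom(WB, UB')) (rA : UA') (rB : UB')
    (CA : set WA) (CB : set WB) :
  (fun y => (TA y.1, TB y.2)) @`
    lifted_feasible FA FB GA GB TA TB RA RB rA rB CA CB =
  feasible FA FB GA GB (TA @` (CA `&` [set y | RA y = rA]))
                       (TB @` (CB `&` [set y | RB y = rB])).
Proof.
apply/seteqP; split=> [_ [[yA yB] /= [[CyA CyB] F0 G0 [RyA RyB]] <-]|].
  by split=> //=; split; [exists yA|exists yB].
move=> [_ _] [[/= [yA [CyA RyA] <-] [yB [CyB RyB] <-]] F0 G0].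
by exists (yA, yB).
Qed.

Lemma optimal_value_image (R : realType) (X Y : Type) (T : Y -> X) (D : set Y)
    (f : X -> R) (g : Y -> R) :
  (forall y, D y -> g y = f (T y)) ->
  optimal_value (T @` D) f = optimal_value D g.
Proof.
move=> gf; rewrite /optimal_value image_comp; congr ereal_inf.
by apply: eq_imagel => y Dy /=; rewrite gf.
Qed.

Lemma optimal_value_min (R : realType) (X : Type) (D : set X) (f : X -> R) x :
  D x -> (forall y, D y -> f x <= f y) -> (f x)%:E = optimal_value D f.
Proof.
move=> Dx minx; apply/eqP; rewrite eq_le; apply/andP; split.
  by apply: le_ereal_inf_tmp => _ [y Dy <-]; rewrite lee_fin; exact: minx.
by apply: ereal_inf_lbound; exists x.
Qed.

Theorem proposition4p3 (R : realType)
  (VA VB WA WB UA UB UA' UB' : vectType R) (OA OB : orderedVectType R)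
  (KA : set VA) (KB : set VB) (CA : set WA) (CB : set WB)
  (TA : 'Hom(WA, VA)) (TB : 'Hom(WB, VB))
  (RA : 'Hom(WA, UA')) (RB : 'Hom(WB, UB')) (rA : UA') (rB : UB')
  (FA : 'Hom(VA, UA)) (FB : 'Hom(VB, UB))
  (GA : 'Hom(VA, OA)) (GB : 'Hom(VB, OB))
  (P : 'Hom(tensor VA VB, R^o))
  (hKA : convex_body KA) (hKB : convex_body KB)
  (hCA : proper_cone CA) (hCB : proper_cone CB)
  (liftA : KA = TA @` (CA `&` [set yA | RA yA = rA]))
  (liftB : KB = TB @` (CB `&` [set yB | RB yB = rB])) :
  let Pt : 'Hom(tensor WA WB, R^o) := lifted_functional P TA TB in
  let D : set (VA * VB) := feasible FA FB GA GB KA KB in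
  let Dl : set (WA * WB) :=
    lifted_feasible FA FB GA GB TA TB RA RB rA rB CA CB in
  let obj (x : VA * VB) : R := P (x.1 \ox x.2) in
  let objl (y : WA * WB) : R := Pt (y.1 \ox y.2) in
  let T (y : WA * WB) : VA * VB := (TA y.1, TB y.2) in
  [/\ T @` Dl = D,
      forall y, Dl y -> objl y = obj (T y),
      optimal_value D obj = optimal_value Dl objl &
      (* a minimum, not only an infimum; fails for non-closed order cones *)
      vclosed [set u : OA | 0 <= u] -> vclosed [set u : OB | 0 <= u] ->
      D !=set0 -> exists2 x, D x & (obj x)%:E = optimal_value D obj].
Proof.
move=> Pt D Dl obj objl T.
have TDl : T @` Dl = D by rewrite /D liftA liftB -lifted_feasible_image.
have objT y : Dl y -> objl y = obj (T y).
  by move=> _; exact: lifted_functionalE.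
split=> //; first by rewrite -TDl; exact: optimal_value_image.
move=> clOA clOB.
have [[_ cKA _] [_ cKB _]] := (hKA, hKB).
rewrite /D feasible_setX => D0.
(* The objective is the lift of [P] along the identity maps, which exhibits it
   as a bilinear form. *)
have [x Dx minx] := bilinear_attains_min (lifted_form P \1%VF \1%VF)
  (vcompact_slice FA GA cKA clOA) (vcompact_slice FB GB cKB clOB) D0.
exists x => //; apply: optimal_value_min => // y /minx.
by rewrite /= /lifted_form !id_lfunE.
Qed.
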